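(* Let $T$ be a bountiful type of structure, let $(X,\leq)$ be the poset of all structures of type $T$ under the consecutive order, let $B\subseteq X$ be finite and suppose $C=\mathrm{Av}(B)$ is infinite. Let $b$ be the maximum length of an element of $B$ ($b=1$ if $B=\varnothing$) and let $\Gamma_C$ be the $b$-dimensional factor graph of $C$. Then $C$ is atomic if and only if: (1) $\Gamma_C$ is strongly connected; and (2) for each $\sigma\in C$ with $1\le|\sigma|\le b-1$ there is $\rho\in C$ with $|\rho|=b$ such that $\sigma\leq\rho$.
   Context: Conventions: $\mathbb{N}=\{1,2,3,\dots\}$ and $[m,n]=\{m,m+1,\dots,n\}$. Structures. Fix a finite sequence of positive arities whose first entry is $2$ (the signature). A structure is a pair $(X,R)$ with $X$ a finite nonempty subset of $\mathbb{N}$ and $R$ a sequence of relations on $X$ of these arities, the first of which is the linear order on $X$ inherited from $\mathbb{N}$. Two structures of the same signature are isomorphic ($\cong$) if relabelling the points of each in increasing order by $1,2,\dots$ gives exactly the same structure; isomorphic structures are considered equal, so every structure may be taken to have underlying set $[1,n]$. Its length is $|(X,R)|=|X|$. For $Y\subseteq X$, $\sigma\upharpoonright_Y$ is the restriction of $\sigma$ to the points in $Y$; restrictions to the empty set are all regarded as isomorphic. A type of structure is a class of structures of one fixed signature satisfying some additional conditions (possibly none), closed under isomorphism and under restriction to nonempty sets of consecutive points. Consecutive order: for $\sigma,\rho$ of the same type, $\sigma\leq\rho$ iff $\sigma\cong\rho\upharpoonright_{[k,k+|\sigma|-1]}$ for some $k\ge 1$ with $k+|\sigma|-1\le|\rho|$.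 Valid types. Let $|\sigma|=p$, $|\rho|=q$. Then $\sigma$ and $\rho$ overlap (on $x$ points) if $\sigma\upharpoonright_{[p-x+1,p]}\cong\rho\upharpoonright_{[1,x]}$ for some $x\geq 1$. A structure $\theta$ of the same type with $|\theta|=p+q-x$ combines them if $\theta\upharpoonright_{[1,p]}\cong\sigma$ and $\theta\upharpoonright_{[p-x+1,p+q-x]}\cong\rho$. A type is valid if for any two structures of this type overlapping on $x$ points there is a structure of the same type combining them. Bountiful types. A valid type is bountiful if for any $m\in\mathbb{N}$ and any structures $\sigma,\rho$ of this type with $|\sigma|=|\rho|=m$ and $\sigma\upharpoonright_{[2,m]}\cong\rho\upharpoonright_{[1,m-1]}$, there exist at least two (distinct) structures $\theta_1,\theta_2$ of the type, of length $m+1$, with $\theta_i\upharpoonright_{[1,m]}\cong\sigma$ and $\theta_i\upharpoonright_{[2,m+1]}\cong\rho$ for $i=1,2$. Avoidance sets: $\mathrm{Av}(B)=\{x\in X: b'\nleq x \text{ for all } b'\in B\}$. A downward closed subset $C$ of a poset is atomic if it is not the union of two downward closed proper subsets of $C$; equivalently (joint embedding property) for all $x,y\in C$ there is $z\in C$ with $x,y\leq z$. Factor graph: for $m\ge b$, the $m$-dimensional factor graph $\Gamma_C^m$ is the digraph whose vertices are the structures in $C$ of length $m$, with an edge $u\to v$ iff $u\upharpoonright_{[2,m]}\cong v\upharpoonright_{[1,m-1]}$ (loops allowed); $\Gamma_C=\Gamma_C^b$. A digraph is strongly connected if for any two vertices $u,v$ there is a path from $u$ to $v$. *)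

(* Defs.v *)
From mathcomp Require Import all_boot.
From mathcomp Require Import classical_sets cardinality.
From Stdlib Require Import Relation_Operators.

Set Implicit Arguments.
Unset Strict Implicit.
Unset Printing Implicit Defensive.

Local Open Scope classical_set_scope.
Local Open Scope nat_scope.

(** * Structures *)

(* The leading arity 2, that of the linear order, is not stored in the
   record: the full sequence of arities is [arities]. *)
Record signature := Signature {
  other_arities : seq nat;
  other_arities_gt0 : all (leq 1) other_arities }.

Definition arities (s : signature) : seq nat := 2 :: other_arities s.

Definition arity (s : signature) (i : 'I_(size (arities s))) : nat :=
  nth 0 (arities s) i.

(* Sequences of relations, of the arities given by [s], on n points.  The points
   are 0, ..., n-1 rather than 1, ..., n.  Since all arities are positive, there
   is exactly one such sequence for n = 0, so that all restrictions to the
   empty set are equal. *)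
Definition relations (s : signature) (n : nat) : Type :=
  {dffun forall i : 'I_(size (arities s)), {set (arity i).-tuple 'I_n}}.

(* Isomorphic structures are identified: each one is represented by its unique
   copy on an initial segment of the natural numbers.  Hence the isomorphism
   relation is Leibniz equality, and every class of structures is closed
   under isomorphism. *)
Record structure (s : signature) := Structure {
  len : nat;
  rels : relations s len;
  len_gt0 : 0 < len;
  rels_order :
    rels ord0 == [set t : 2.-tuple 'I_len | tnth t ord0 <= tnth t ord_max]%SET }.

Lemma shift_subproof (k m n : nat) (le_km_n : k + m <= n) (i : 'I_m) :
  k + i < n.
Proof. by apply: leq_trans le_km_n; rewrite ltn_add2l. Qed.

Definition shift (k m n : nat) (le_km_n : k + m <= n) (i : 'I_m) : 'I_n :=
  Ordinal (shift_subproof le_km_n i).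

(* The restriction of R to the m consecutive points k, ..., k + m - 1,
   relabelled in increasing order by 0, ..., m - 1. *)
Definition restrict (s : signature) (k m n : nat) (le_km_n : k + m <= n)
    (R : relations s n) : relations s m :=
  [ffun i => [set t | map_tuple (shift le_km_n) t \in R i]%SET].

(* The restriction of sigma to its m points starting at k is isomorphic to the
   restriction of rho to its m points starting at l; both ranges are required to
   lie inside the structures. *)
Definition iso_restrict (s : signature) (sigma : structure s) (k : nat)
    (rho : structure s) (l m : nat) : Prop :=
  exists (hk : k + m <= len sigma) (hl : l + m <= len rho),
    restrict hk (rels sigma) = restrict hl (rels rho).

(* sigma is isomorphic to the restriction of rho to its len sigma consecutive
   points starting at k. *)
Definition occurs_at (s : signature) (sigma : structure s) (k : nat)
    (rho : structure s) : Prop :=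
  exists h : k + len sigma <= len rho, rels sigma = restrict h (rels rho).

Definition consec (s : signature) (sigma rho : structure s) : Prop :=
  exists k, occurs_at sigma k rho.

(** * Types of structures *)

Definition is_type (s : signature) (T : set (structure s)) : Prop :=
  forall sigma rho k, T rho -> occurs_at sigma k rho -> T sigma.

Definition overlap (s : signature) (sigma rho : structure s) (x : nat) : Prop :=
  1 <= x /\ iso_restrict sigma (len sigma - x) rho 0 x.

Definition combines (s : signature) (theta sigma rho : structure s) (x : nat) :
    Prop :=
  [/\ len theta = len sigma + len rho - x,
      occurs_at sigma 0 theta
    & occurs_at rho (len sigma - x) theta].

Definition valid (s : signature) (T : set (structure s)) : Prop :=
  is_type T /\
  forall sigma rho x, T sigma -> T rho -> overlap sigma rho x ->
    exists theta, T theta /\ combines theta sigma rho x.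

Definition joins (s : signature) (m : nat) (sigma rho theta : structure s) :
    Prop :=
  [/\ len theta = m.+1, occurs_at sigma 0 theta & occurs_at rho 1 theta].

Definition bountiful (s : signature) (T : set (structure s)) : Prop :=
  valid T /\
  forall m sigma rho, 1 <= m -> T sigma -> T rho ->
    len sigma = m -> len rho = m ->
    iso_restrict sigma 1 rho 0 (m - 1) ->
    exists theta1 theta2, [/\ T theta1, T theta2, theta1 <> theta2,
      joins m sigma rho theta1 & joins m sigma rho theta2].

(** * Downward closed sets; the poset is the set X ordered by le *)

Definition avoid (U : Type) (X : set U) (le : U -> U -> Prop) (B : set U) :
    set U :=
  [set x | X x /\ forall b, B b -> ~ le b x].

Definition down_closed (U : Type) (X : set U) (le : U -> U -> Prop)
    (D : set U) : Prop :=
  D `<=` X /\ forall x y, X x -> D y -> le x y -> D x.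

Definition atomic (U : Type) (X : set U) (le : U -> U -> Prop) (C : set U) :
    Prop :=
  down_closed X le C /\
  ~ exists D E : set U,
      [/\ down_closed X le D, down_closed X le E, D `<` C, E `<` C
        & C = D `|` E].

(** * Factor graphs *)

Definition max_length (s : signature) (B : set (structure s)) (b : nat) : Prop :=
  (B = set0 /\ b = 1) \/
  ((exists beta, B beta /\ len beta = b) /\
   forall beta, B beta -> len beta <= b).

Definition factor_vertex (s : signature) (C : set (structure s)) (m : nat) :
    set (structure s) :=
  [set u | C u /\ len u = m].

Definition factor_edge (s : signature) (C : set (structure s)) (m : nat)
    (u v : structure s) : Prop :=
  [/\ factor_vertex C m u, factor_vertex C m v & iso_restrict u 1 v 0 (m - 1)].

Definition strongly_connected (U : Type) (V : set U) (E : U -> U -> Prop) :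
    Prop :=
  forall u v, V u -> V v -> clos_refl_trans U E u v.

(* Main.v *)
Require Import Defs.
From mathcomp Require Import all_boot.
From mathcomp Require Import classical_sets cardinality.
From mathcomp Require Import boolp zify.
From Stdlib Require Import Relation_Operators Eqdep_dec.

(** Reading the windows of length b of a member of C from left to right gives a
    walk in the factor graph.  Conversely a walk can be glued into a member of
    C: a factor of length at most b of a structure glued along at least b - 1
    points lies in one of the two pieces ([avoid_glue]), so gluing members of C
    inside T never creates a forbidden factor, and every edge of the graph comes
    from structures of length b + 1 in C ([edge_joins]).

    Atomicity is the joint embedding property ([atomicP]).

    Strong connectivity and the extension condition give joint embedding of x
    and y: extend both to length at least b, walk from the last window of x to
    the first window of y while extending x ([extend_along_path]), and glue on y.

    Conversely, let C have joint embedding.  As there are finitely many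
    structures of each length, C has members of length at least b; jointly
    embedding sigma with one of them and cutting out a window around sigma gives
    the extension condition.  For strong connectivity, jointly embedding u and v
    yields a walk between them, but possibly from v to u.  Here bountifulness decides: an edge from a to c comes
    from two different structures of length b + 1, which must occupy different
    places in a common extension, so that an occurrence of c is followed by one
    of a and the edge can be walked back ([edge_reversible]).  Reachability is
    therefore symmetric. *)

Set Implicit Arguments.
Unset Strict Implicit.
Unset Printing Implicit Defensive.

Local Open Scope classical_set_scope.
Local Open Scope nat_scope.

(** * Atomicity and joint embedding *)

Definition joint_embedding (U : Type) (le : U -> U -> Prop) (C : set U) : Prop :=
  forall x y, C x -> C y -> exists z, [/\ C z, le x z & le y z].

(** If x and y have no common upper bound in C, then C is the union of the
    elements not above x and the elements not above y. *)
Lemma atomicP (U : Type) (X : set U) (le : U -> U -> Prop) (C : set U)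
    (le_refl : forall x, le x x)
    (le_trans : forall x y z, le x y -> le y z -> le x z)
    (dC : down_closed X le C) :
  atomic X le C <-> joint_embedding le C.
Proof.
have [CX downC] := dC.
have avoid_down x : down_closed X le (C `&` [set z | ~ le x z]).
  split=> [z [/CX //]|y z Xy [Cz xz] yz]; split; first exact: downC yz.
  by move=> xy; apply: xz; apply: le_trans yz.
have avoid_proper x : C x -> (C `&` [set z | ~ le x z]) `<` C.
  move=> Cx; split=> [z []//|CD].
  by have [_] := CD _ Cx; exact.
split=> [[_ nunion] x y Cx Cy|jep].
  apply: contrapT => nz; apply: nunion.
  exists (C `&` [set z | ~ le x z]), (C `&` [set z | ~ le y z]).
  split; [exact: avoid_down|exact: avoid_down|exact: avoid_proper
         |exact: avoid_proper|].
  rewrite -setIUr; apply/seteqP; split=> z; last by case.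
  move=> Cz; split=> //=; apply/not_andP => -[xz yz].
  by apply: nz; exists z.
split=> // -[D [E [[_ downD] [_ downE] [_ nCD] [_ nCE] CDE]]].
move/existsNP: nCD => [x /not_implyP [Cx nDx]].
move/existsNP: nCE => [y /not_implyP [Cy nEy]].
have [z [Cz xz yz]] := jep _ _ Cx Cy.
move: (Cz); rewrite CDE => -[Dz|Ez].
  by apply: nDx; apply: downD xz => //; exact: CX.
by apply: nEy; apply: downE yz => //; exact: CX.
Qed.

(** * Occurrences of structures *)

Lemma restrict_id (s : signature) (n : nat) (h : 0 + n <= n)
    (R : relations s n) : restrict h R = R.
Proof.
apply/ffunP => i; rewrite ffunE; apply/setP => t; rewrite inE.
suff -> : map_tuple (shift h) t = t by [].
by apply: eq_from_tnth => j; rewrite tnth_map; apply: val_inj.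
Qed.

Lemma restrict_restrict (s : signature) (j k l m n p : nat) (hj : j + m <= n)
    (hk : k + n <= p) (hl : l + m <= p) (R : relations s p) :
  l = k + j -> restrict hj (restrict hk R) = restrict hl R.
Proof.
move=> eql; apply/ffunP => i; rewrite !ffunE; apply/setP => t; rewrite !inE.
suff -> : map_tuple (shift hk) (map_tuple (shift hj) t) = map_tuple (shift hl) t.
  by [].
apply: eq_from_tnth => a; rewrite !tnth_map; apply: val_inj => /=.
by rewrite eql addnA.
Qed.

(** A structure is determined by its place in any structure in which it occurs. *)
Lemma occurs_at_inj (s : signature) (x y z : structure s) (k : nat) :
  len x = len y -> occurs_at x k z -> occurs_at y k z -> x = y.
Proof.
case: x y => [n R n0 oR] [n' R' n0' oR'] /= eqn; subst n' => -[h /= eR] [h' /= eR'].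
have {eR'} eRR' : R' = R by rewrite eR eR' (bool_irrelevance h h').
subst R'; by rewrite (bool_irrelevance n0 n0') (bool_irrelevance oR oR').
Qed.

Lemma occurs_at_refl (s : signature) (x : structure s) : occurs_at x 0 x.
Proof. by exists (leqnn _); rewrite restrict_id. Qed.

Lemma occurs_at_trans (s : signature) (x y z : structure s) (j k : nat) :
  occurs_at x j y -> occurs_at y k z -> occurs_at x (k + j) z.
Proof.
move=> [hj ej] [hk ek].
have hl : k + j + len x <= len z by lia.
by exists hl; rewrite ej ek; exact: restrict_restrict.
Qed.

Lemma occurs_at_len (s : signature) (x z : structure s) (k : nat) :
  occurs_at x k z -> k + len x <= len z.
Proof. by case. Qed.

Lemma factor_exists (s : signature) (z : structure s) (k m : nat) :
  0 < m -> k + m <= len z -> exists x, len x = m /\ occurs_at x k z.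
Proof.
move=> m_gt0 hk.
have ord_ok : restrict hk (rels z) ord0
    == [set t : 2.-tuple 'I_m | tnth t ord0 <= tnth t ord_max]%SET.
  rewrite ffunE (eqP (rels_order z)); apply/eqP/setP => t.
  by rewrite !inE !tnth_map /= leq_add2l.
by exists (Structure m_gt0 ord_ok); split=> //; exists hk.
Qed.

Lemma occurs_at_sub (s : signature) (x y z : structure s) (k l : nat) :
  occurs_at x l z -> occurs_at y k z -> k <= l -> l + len x <= k + len y ->
  occurs_at x (l - k) y.
Proof.
move=> xz yz kl lxy.
have hx : l - k + len x <= len y by lia.
have [x' [lenx' x'y]] := factor_exists (len_gt0 x) hx.
have x'z := occurs_at_trans x'y yz; rewrite subnKC // in x'z.
by rewrite -(occurs_at_inj lenx' x'z xz).
Qed.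

Lemma consec_refl (s : signature) (x : structure s) : consec x x.
Proof. by exists 0; exact: occurs_at_refl. Qed.

Lemma consec_trans (s : signature) (x y z : structure s) :
  consec x y -> consec y z -> consec x z.
Proof.
by move=> [j xy] [k yz]; exists (k + j); exact: occurs_at_trans yz.
Qed.

Lemma iso_restrict_common_factor (s : signature) (f x y : structure s)
    (k l : nat) :
  occurs_at f k x -> occurs_at f l y -> iso_restrict x k y l (len f).
Proof. by move=> [hk ek] [hl el]; exists hk, hl; rewrite -ek. Qed.

(** This includes m = 0, where the restrictions are not themselves structures;
    that is the edge relation when b = 1. *)
Lemma iso_restrict_common_extension (s : signature) (x y z : structure s)
    (i j k l m : nat) :
  occurs_at x i z -> occurs_at y j z -> i + k = j + l ->
  k + m <= len x -> l + m <= len y -> iso_restrict x k y l m.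
Proof.
move=> [hi ei] [hj ej] ikjl hk hl; exists hk, hl.
have him : i + k + m <= len z by lia.
rewrite ei ej (restrict_restrict hk hi him) // (restrict_restrict hl hj him) //.
Qed.

(** * Finitely many structures of bounded length *)

Lemma finite_len_lt (s : signature) (b : nat) :
  finite_set [set x : structure s | len x < b].
Proof.
pose code (x : structure s) : {n : nat & relations s n} := existT _ _ (rels x).
have code_inj : injective code.
  move=> x y cxy; apply: (@occurs_at_inj _ _ _ y 0).
  - exact: (congr1 (@projT1 _ _) cxy).
  - case: x y cxy => [n R n0 oR] [n' R' n0' oR'] /= cxy.
    have enn' : n = n' := congr1 (@projT1 _ _) cxy.
    subst n'; have /= eR := inj_pair2_eq_dec _ (@eq_comparable _) _ _ _ _ cxy.
    by exists (leqnn n); rewrite restrict_id.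
  - exact: occurs_at_refl.
pose codes := \bigcup_(n in `I_b)
  [set existT (relations s) n R | R in [set: relations s n]].
apply: (@sub_finite_set _ _ (code @^-1` codes)).
  by move=> x xb; exists (len x) => //; exists (rels x).
apply: finite_preimage; first by move=> x y _ _; exact: code_inj.
apply: bigcup_finite; first exact: finite_II.
move=> n _; apply: finite_image.
exact: (@finite_finset {dffun forall i : 'I_(size (arities s)),
  {set (arity i).-tuple 'I_n}}).
Qed.

Lemma infinite_long (s : signature) (C : set (structure s)) (b : nat) :
  infinite_set C -> exists x, C x /\ b <= len x.
Proof.
move=> Cinf; apply: contrapT => nx; apply: Cinf.
apply: sub_finite_set (finite_len_lt s b) => x Cx /=.
by rewrite ltnNge; apply/negP => bx; apply: nx; exists x.
Qed.

(** * Avoidance classes and their factor graphs *)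

Lemma avoid_down_closed (U : Type) (X B : set U) (le : U -> U -> Prop) :
  (forall x y z, le x y -> le y z -> le x z) ->
  down_closed X le (avoid X le B).
Proof.
move=> le_trans; split=> [x []//|x y Xx [_ By] xy]; split=> // beta Bb bx.
by apply: By Bb _; exact: le_trans xy.
Qed.

Lemma factor_avoid (s : signature) (T B : set (structure s)) (x z : structure s)
    (k : nat) :
  is_type T -> avoid T (@consec s) B z -> occurs_at x k z ->
  avoid T (@consec s) B x.
Proof.
move=> typT Cz xz; have [_ down] := avoid_down_closed T B (@consec_trans s).
have [Tz _] := Cz.
by apply: (down _ z) => //; [exact: typT xz|exists k].
Qed.

Lemma max_length_gt0 (s : signature) (B : set (structure s)) (b : nat) :
  max_length B b -> 0 < b.
Proof. by case=> [[_ ->]//|[[beta [_ <-]] _]]; exact: len_gt0. Qed.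

Lemma max_length_le (s : signature) (B : set (structure s)) (b : nat) :
  max_length B b -> forall beta, B beta -> len beta <= b.
Proof. by case=> [[-> _] beta []|[_ le_b]]. Qed.

(** With an overlap of at least b - 1 points, an occurrence of a forbidden
    factor that is not inside x must start at or after the start of y. *)
Lemma avoid_glue (s : signature) (T B : set (structure s)) (b k : nat)
    (x y z : structure s) :
  (forall beta, B beta -> len beta <= b) ->
  avoid T (@consec s) B x -> avoid T (@consec s) B y -> T z ->
  occurs_at x 0 z -> occurs_at y k z ->
  len z = k + len y -> k + b <= (len x).+1 ->
  avoid T (@consec s) B z.
Proof.
move=> le_b [_ Bx] [_ By] Tz xz yz lenz kb; split=> // beta Bbeta [i bz].
have lb := le_b _ Bbeta; have := occurs_at_len bz => ib.
have [inx|outx] := leqP (i + len beta) (len x).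
  by apply: (Bx _ Bbeta); exists (i - 0); apply: occurs_at_sub bz xz _ _; lia.
by apply: (By _ Bbeta); exists (i - k); apply: occurs_at_sub bz yz _ _; lia.
Qed.

(** The two joining structures given by bountifulness are glued along b - 1
    points, just enough for them to stay in the class. *)
Lemma edge_joins (s : signature) (T B : set (structure s)) (b : nat)
    (u v : structure s) :
  bountiful T -> max_length B b ->
  factor_edge (avoid T (@consec s) B) b u v ->
  exists x y, [/\ avoid T (@consec s) B x, avoid T (@consec s) B y, x <> y,
    joins b u v x & joins b u v y].
Proof.
move=> [_ bountT] hb [[Cu lu] [Cv lv] uv].
have joinC z : T z -> joins b u v z -> avoid T (@consec s) B z.
  by move=> Tz [lz uz vz]; apply: (avoid_glue (max_length_le hb) Cu Cv Tz uz vz); lia.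
have [Tu _] := Cu; have [Tv _] := Cv.
have [x [y [Tx Ty xy jx jy]]] :=
  bountT _ _ _ (max_length_gt0 hb) Tu Tv lu lv uv.
by exists x, y; split=> //; exact: joinC.
Qed.

(** Appending one point per edge keeps the last window equal to the current
    vertex of the walk. *)
Lemma extend_along_path (s : signature) (T B : set (structure s)) (b : nat)
    (u v : structure s) :
  bountiful T -> max_length B b ->
  clos_refl_trans _ (factor_edge (avoid T (@consec s) B) b) u v ->
  forall x, avoid T (@consec s) B x -> b <= len x ->
    occurs_at u (len x - b) x ->
  exists z, [/\ avoid T (@consec s) B z, occurs_at x 0 z
    & occurs_at v (len z - b) z].
Proof.
move=> bountT hb; have b_gt0 := max_length_gt0 hb.
elim=> {u v} [u v uv|u|u v w _ IHuv _ IHvw] x Cx bx ux; last first.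
- have [y [Cy xy vy]] := IHuv _ Cx bx ux.
  have xley := occurs_at_len xy.
  have b_le_y : b <= len y by lia.
  have [z [Cz yz wz]] := IHvw _ Cy b_le_y vy.
  by exists z; split=> //; exact: (occurs_at_trans xy yz).
- by exists x; split=> //; exact: occurs_at_refl.
have [y [_ [Cy _ _ [ly uy vy] _]]] := edge_joins bountT hb uv.
have [[_ combT] _] := bountT.
have [[_ lu] _ _] := uv.
(* Gluing y, and not v, keeps the overlap nonempty even when b = 1. *)
have ov : overlap x y b.
  by split=> //; rewrite -[X in iso_restrict _ _ _ _ X]lu;
    exact: iso_restrict_common_factor.
have [Tx _] := Cx; have [Ty _] := Cy.
have [z [Tz [lz xz yz]]] := combT _ _ _ Tx Ty ov.
exists z; split=> //.
  apply: (avoid_glue (max_length_le hb) Cx Cy Tz xz yz); lia.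
have -> : len z - b = len x - b + 1 by lia.
exact: occurs_at_trans yz.
Qed.

Lemma window_path (s : signature) (T B : set (structure s)) (b i j : nat)
    (u v z : structure s) :
  is_type T -> 0 < b -> avoid T (@consec s) B z ->
  len u = b -> len v = b -> occurs_at u i z -> occurs_at v j z -> i <= j ->
  clos_refl_trans _ (factor_edge (avoid T (@consec s) B) b) u v.
Proof.
move=> typT b_gt0 Cz lu lv uz vz ij.
have {ij} [d ejd] : exists d, j = i + d by exists (j - i); lia.
subst j; elim: d v lv vz => [|d IHd] v lv vz.
  rewrite addn0 in vz; rewrite (occurs_at_inj _ uz vz) ?lu //.
  exact: rt_refl.
have vlez := occurs_at_len vz.
have [||w [lw wz]] := @factor_exists _ z (i + d) b; [lia|lia|].
apply: rt_trans (IHd _ lw wz) _; apply: rt_step; split.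
- by split=> //; exact: factor_avoid wz.
- by split=> //; exact: factor_avoid vz.
- by apply: (iso_restrict_common_extension wz vz); lia.
Qed.

(** Two different structures of length b + 1 joining u and v start at different
    points of a common extension, so the v of the earlier one starts no later
    than the u of the other one. *)
Lemma edge_reversible (s : signature) (T B : set (structure s)) (b : nat)
    (u v : structure s) :
  bountiful T -> max_length B b ->
  joint_embedding (@consec s) (avoid T (@consec s) B) ->
  factor_edge (avoid T (@consec s) B) b u v ->
  clos_refl_trans _ (factor_edge (avoid T (@consec s) B) b) v u.
Proof.
move=> bountT hb jep uv.
have [x [y [Cx Cy nxy [lx ux vx] [ly uy vy]]]] := edge_joins bountT hb uv.
have [z [Cz [i xz] [j yz]]] := jep _ _ Cx Cy.
have [[_ lu] [_ lv] _] := uv; have [[typT _] _] := bountT.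
have b_gt0 := max_length_gt0 hb.
have nij : i <> j.
  move=> ij; subst j; apply: nxy.
  by apply: occurs_at_inj xz yz; rewrite lx ly.
have [ij|ji] : i + 1 <= j + 0 \/ j + 1 <= i + 0 by lia.
  exact: window_path (occurs_at_trans vx xz) (occurs_at_trans uy yz) ij.
exact: window_path (occurs_at_trans vy yz) (occurs_at_trans ux xz) ji.
Qed.

Lemma path_reversible (s : signature) (T B : set (structure s)) (b : nat)
    (u v : structure s) :
  bountiful T -> max_length B b ->
  joint_embedding (@consec s) (avoid T (@consec s) B) ->
  clos_refl_trans _ (factor_edge (avoid T (@consec s) B) b) u v ->
  clos_refl_trans _ (factor_edge (avoid T (@consec s) B) b) v u.
Proof.
move=> bountT hb jep; elim=> {u v} [u v uv|u|u v w _ vu _ wv].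
- exact: edge_reversible uv.
- exact: rt_refl.
- exact: rt_trans wv vu.
Qed.

(** * Joint embedding in terms of the factor graph *)

Lemma joint_embedding_strongly_connected (s : signature)
    (T B : set (structure s)) (b : nat) :
  bountiful T -> max_length B b ->
  joint_embedding (@consec s) (avoid T (@consec s) B) ->
  strongly_connected (factor_vertex (avoid T (@consec s) B) b)
    (factor_edge (avoid T (@consec s) B) b).
Proof.
move=> bountT hb jep u v [Cu lu] [Cv lv].
have [[typT _] _] := bountT; have b_gt0 := max_length_gt0 hb.
have [z [Cz [i uz] [j vz]]] := jep _ _ Cu Cv.
have [ij|ji] := leqP i j; first exact: window_path uz vz ij.
by apply: path_reversible => //; exact: window_path vz uz (ltnW ji).
Qed.

Lemma joint_embedding_extend (s : signature) (T B : set (structure s)) (b : nat)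
    (x : structure s) :
  is_type T -> infinite_set (avoid T (@consec s) B) ->
  joint_embedding (@consec s) (avoid T (@consec s) B) ->
  avoid T (@consec s) B x -> len x <= b ->
  exists y, [/\ avoid T (@consec s) B y, len y = b & consec x y].
Proof.
move=> typT Cinf jep Cx xb; have x_gt0 := len_gt0 x.
have [y [Cy by_]] := infinite_long b Cinf.
have [z [Cz [i xz] [j yz]]] := jep _ _ Cx Cy.
have xlez := occurs_at_len xz; have ylez := occurs_at_len yz.
(* The window starts where x does, unless that leaves too few points. *)
pose k := minn i (len z - b).
have [||w [lw wz]] := @factor_exists _ z k b; [lia|lia|].
exists w; split=> //; first exact: factor_avoid wz.
by exists (i - k); apply: occurs_at_sub xz wz _ _; lia.
Qed.

Lemma strongly_connected_joint_embedding (s : signature)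
    (T B : set (structure s)) (b : nat) :
  bountiful T -> max_length B b ->
  strongly_connected (factor_vertex (avoid T (@consec s) B) b)
    (factor_edge (avoid T (@consec s) B) b) ->
  (forall x, avoid T (@consec s) B x -> 1 <= len x <= b - 1 ->
     exists y, [/\ avoid T (@consec s) B y, len y = b & consec x y]) ->
  joint_embedding (@consec s) (avoid T (@consec s) B).
Proof.
move=> bountT hb sconn ext x0 y0 Cx0 Cy0.
have [[typT combT] _] := bountT; have b_gt0 := max_length_gt0 hb.
have long x : avoid T (@consec s) B x ->
    exists y, [/\ avoid T (@consec s) B y, b <= len y & consec x y].
  move=> Cx; have [bx|xb] := leqP b (len x).
    by exists x; split=> //; exact: consec_refl.
  have x_gt0 := len_gt0 x.
  have [|y [Cy ly xy]] := ext _ Cx; first by lia.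
  by exists y; split=> //; rewrite ly.
have [x [Cx bx x0x]] := long _ Cx0; have [y [Cy by_ y0y]] := long _ Cy0.
have [||u [lu ux]] := @factor_exists _ x (len x - b) b; [lia|lia|].
have [||v [lv vy]] := @factor_exists _ y 0 b; [lia|lia|].
have uv : clos_refl_trans _ (factor_edge (avoid T (@consec s) B) b) u v.
  by apply: sconn; split=> //; [exact: factor_avoid ux|exact: factor_avoid vy].
have [w [Cw xw vw]] := extend_along_path bountT hb uv Cx bx ux.
have xlew := occurs_at_len xw.
have ov : overlap w y b.
  by split=> //; rewrite -[X in iso_restrict _ _ _ _ X]lv;
    exact: iso_restrict_common_factor.
have [Tw _] := Cw; have [Ty _] := Cy.
have [z [Tz [lz wz yz]]] := combT _ _ _ Tw Ty ov.
exists z; split.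
- apply: (avoid_glue (max_length_le hb) Cw Cy Tz wz yz); lia.
- apply: consec_trans x0x _; exists (0 + 0); exact: occurs_at_trans wz.
- by apply: consec_trans y0y _; exists (len w - b).
Qed.

Theorem corollary8p2 (s : signature) (T B C : set (structure s)) (b : nat)
  (hT : bountiful T)
  (hBT : B `<=` T) (hBfin : finite_set B)
  (hC : C = avoid T (@consec s) B) (hCinf : infinite_set C)
  (hb : max_length B b) :
  atomic T (@consec s) C <->
  (strongly_connected (factor_vertex C b) (factor_edge C b) /\
   forall sigma, C sigma -> 1 <= len sigma <= b - 1 ->
     exists rho, [/\ C rho, len rho = b & consec sigma rho]).
Proof.
subst C; have [[typT _] _] := hT.
apply: iff_trans (atomicP (@consec_refl s) (@consec_trans s)
  (avoid_down_closed T B (@consec_trans s))) _.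
split=> [jep|[sconn ext]].
  split; first exact: joint_embedding_strongly_connected.
  move=> x Cx xb; apply: joint_embedding_extend => //; lia.
exact: strongly_connected_joint_embedding ext.
Qed.
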